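(* Let $n\ge 1$. The bottom map $$\operatorname{bot}\colon (A_n,\le)\longrightarrow (B_n,\le)$$ is a poset embedding (that is, $x\le y$ if and only if $\operatorname{bot}(x)\le\operatorname{bot}(y)$ for all $x,y\in A_n$) with image the lower Bruhat interval $[\mathrm{id},b_0]$, where $$b_0=(n-1)(n-2)\cdots 1\,\overline{n}.$$ This interval consists precisely of the signed permutations in $B_n$ with at most one negative entry.
   Context: $A_n$ is the group of permutations of $\{0,1,\ldots,n\}$, written in one-line notation $x=x_0x_1\cdots x_n$, with simple reflections $s'_0,\ldots,s'_{n-1}$; right multiplication by $s'_i$ interchanges the entries $x_i$ and $x_{i+1}$. $B_n$ is the group of signed permutations $w=w_1\cdots w_n$ (each $w_i\in\{\pm1,\ldots,\pm n\}$ and $\{|w_1|,\ldots,|w_n|\}=\{1,\ldots,n\}$), with simple reflections $s_0,\ldots,s_{n-1}$; right multiplication by $s_i$ ($1\le i\le n-1$) interchanges the entries in positions $i$ and $i+1$, and right multiplication by $s_0$ changes the sign of the first entry. A bar denotes negation: $\overline a=-a$. Both groups carry the Bruhat order $\le$ with respect to these generators, and $[\mathrm{id},w]=\{u:u\le w\}$. The bottom map $\operatorname{bot}\colon A_n\to B_n$ is defined as follows: for $x=x_0x_1\cdots x_n\in A_n$, delete the first entry $x_0$; if $x_0\ne 0$, replace the remaining entry $0$ by $\overline{x_0}$. The resulting signed permutation is $\operatorname{bot}(x)$. For example, $\operatorname{bot}(0231)=231$ and $\operatorname{bot}(2310)=31\overline 2$. *)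

(* Defs.v *)
From HB Require Import structures.
From mathcomp Require Import all_boot all_fingroup zify.

Set Implicit Arguments.
Unset Strict Implicit.
Unset Printing Implicit Defensive.

Import GroupScope.

Section Bruhat.
Variables (gT : finGroupType) (S : {set gT}).

(* [S ^+ k] is the set of products of k elements of S. If S generates gT, every
   element is such a product for some k < #|gT|, so the search succeeds. *)
Definition cox_length (w : gT) : nat :=
  find (fun k => w \in S ^+ k) (iota 0 #|gT|).

Definition reflections : {set gT} := class_support S [set: gT].

Definition bruhat_step : rel gT := fun u w =>
  [exists t in reflections, w == u * t] && (cox_length u < cox_length w).

(* [connect] is the reflexive transitive closure. The order is the same for gT
   and for its opposite group: reversing words preserves lengths, and
   u * t = (u * t * u^-1) * u with u * t * u^-1 again a reflection. It is
   therefore insensitive to [*] on {perm T} meaning (s * t) i = t (s i). *)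
Definition bruhat : rel gT := connect bruhat_step.

Definition lower_interval (w : gT) : {set gT} := [set u | bruhat u w].

End Bruhat.

(* The word x_0 x_1 ... x_n is the permutation i |-> x_i. *)
Definition An (n : nat) : finGroupType := {perm 'I_n.+1}.

Definition simple_A (n : nat) (i : 'I_n) : An n :=
  tperm (widen_ord (leqnSn n) i) (lift ord0 i).

Definition simples_A (n : nat) : {set An n} := [set simple_A i | i : 'I_n].

(* (k, false) stands for the integer k + 1 and (k, true) for - (k + 1). *)
Definition letter (n : nat) : finType := ('I_n * bool)%type.

Definition neg_letter (n : nat) (a : letter n) : letter n := (a.1, ~~ a.2).

Lemma neg_letterK (n : nat) : involutive (@neg_letter n).
Proof. by case=> k b; rewrite /neg_letter /= negbK. Qed.

Definition neg_perm (n : nat) : {perm letter n} :=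
  perm (can_inj (@neg_letterK n)).

(* Signed permutations, as the permutations w of {1, -1, ..., n, -n} such that
   w (- a) = - w a for all a. *)
Definition Bn (n : nat) : finGroupType := subg_of 'C[neg_perm n]%G.

(* The word w_1 ... w_n; position k + 1 of the word is indexed by k : 'I_n. *)
Definition one_line (n : nat) (w : Bn n) (i : 'I_n) : letter n :=
  sgval w (i, false).

Section OfWord.
Variables (n : nat) (f : 'I_n -> letter n).
Hypothesis f_inj : injective (fun i => (f i).1).

Definition word_ext (a : letter n) : letter n :=
  ((f a.1).1, (f a.1).2 (+) a.2).

Lemma word_ext_inj : injective word_ext.
Proof. by case=> i b [j c] [] /f_inj -> /addbI ->. Qed.

Lemma word_ext_cent : perm word_ext_inj \in 'C[neg_perm n].
Proof.
apply/cent1P/permP=> -[i b]; rewrite !permM !permE /word_ext /neg_letter /=.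
by rewrite addbN.
Qed.

Definition of_word : Bn n := Subg word_ext_cent.

Lemma one_line_of_word i : one_line of_word i = f i.
Proof. by rewrite /one_line /= permE /word_ext /= addbF; case: (f i). Qed.

End OfWord.

Lemma one_line_inj (n : nat) (u w : Bn n) : one_line u =1 one_line w -> u = w.
Proof.
move=> e; apply/val_inj/permP=> -[i b].
have E (v : Bn n) : sgval v (i, true) = neg_letter (sgval v (i, false)).
  have /cent1P/permP/(_ (i, false)) := subgP v.
  by rewrite !permM !permE.
by case: b; [rewrite /= !E; congr neg_letter|]; apply: e.
Qed.

Definition simple_B_word (n : nat) (i j : 'I_n) : letter n :=
  if i == 0 :> nat then (j, j == i) else (tperm (ord_pred i) i j, false).

Lemma simple_B_word_inj (n : nat) (i : 'I_n) :
  injective (fun j => (simple_B_word i j).1).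
Proof.
by rewrite /simple_B_word; case: eqP => _ j k //= /perm_inj.
Qed.

Definition simple_B (n : nat) (i : 'I_n) : Bn n :=
  of_word (@simple_B_word_inj n i).

Definition simples_B (n : nat) : {set Bn n} := [set simple_B i | i : 'I_n].

(* In terms of composition of functions, [simple_B i * w] is w \o simple_B i,
   i.e. the right multiple of w by the i-th generator. *)
Lemma one_line_simple_B (n : nat) (i j : 'I_n) (w : Bn n) :
  one_line (simple_B i * w) j =
  if i == 0 :> nat then
    if j == i then neg_letter (one_line w j) else one_line w j
  else one_line w (tperm (ord_pred i) i j).
Proof.
have N k : sgval w (k, true) = neg_letter (one_line w k).
  by have /cent1P/permP/(_ (k, false)) := subgP w; rewrite !permM !permE.
rewrite {1}/one_line /= permM permE /word_ext /simple_B_word /= -N.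
by case: ifP => //= _; rewrite addbF; case: ifP.
Qed.

(* [unlift ord0 a] is None if a = 0, and Some k if a = k + 1. The inner None
   case does not occur, since x_0 and x_(i+1) are not both 0. *)
Definition bot_word (n : nat) (x : An n) (i : 'I_n) : letter n :=
  if unlift ord0 (x (lift ord0 i)) is Some k then (k, false)
  else if unlift ord0 (x ord0) is Some k then (k, true)
  else (i, false).

Lemma bot_word_inj (n : nat) (x : An n) : injective (fun i => (bot_word x i).1).
Proof.
have x0 i : x (lift ord0 i) = x ord0 -> False.
  by move/perm_inj/eqP; rewrite eq_sym (negPf (neq_lift _ _)).
move=> i j; rewrite /bot_word.
case: (unliftP ord0 (x (lift ord0 i))) => [k|] Ei;
case: (unliftP ord0 (x (lift ord0 j))) => [l|] Ej /=;
case: (unliftP ord0 (x ord0)) => [m|] E0 /= e;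
  try by [case: (x0 i); rewrite Ei E0 ?e | case: (x0 j); rewrite Ej E0 -?e].
- by apply/(@lift_inj _ ord0)/(@perm_inj _ x); rewrite Ei Ej e.
- by apply/(@lift_inj _ ord0)/(@perm_inj _ x); rewrite Ei Ej e.
- by apply/(@lift_inj _ ord0)/(@perm_inj _ x); rewrite Ei Ej.
Qed.

Definition bot (n : nat) (x : An n) : Bn n := of_word (@bot_word_inj n x).

Lemma b0_subproof (n : nat) (i : 'I_n) : n - i.+2 < n.
Proof. by case: n i => [[]|n i] //; rewrite subSS ltnS leq_subr. Qed.

(* Entry n - 1 - i at position i + 1 for i < n - 1, then - n at position n. *)
Definition b0_word (n : nat) (i : 'I_n) : letter n :=
  if i.+1 == n then (i, true) else (Ordinal (b0_subproof i), false).

Lemma b0_word_inj (n : nat) : injective (fun i : 'I_n => (b0_word i).1).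
Proof.
move=> i j; rewrite /b0_word => e; apply/val_inj; move/(congr1 val): e.
have := ltn_ord i; have := ltn_ord j.
case: eqP => hi; case: eqP => hj /=; lia.
Qed.

Definition b0 (n : nat) : Bn n := of_word (@b0_word_inj n).

Definition num_neg (n : nat) (w : Bn n) : nat :=
  #|[set i : 'I_n | (one_line w i).2]|.

(* Main.v *)
Require Import Defs.
From mathcomp Require Import all_boot all_fingroup zify.

Set Implicit Arguments.
Unset Strict Implicit.
Unset Printing Implicit Defensive.

Import GroupScope.

(** In both groups a Bruhat step from u to w exchanges two entries of u, in
    positions a < b with u(a) < u(b); in type B the positions run over 1, ..., n and their
    negatives, and the entries in positions -a and -b are exchanged as well, so
    that the case b = -a is a change of sign ([bruhat_step_A],
    [bruhat_step_B]).

    Under bot these moves match one for one.  Exchanging two entries of x in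
    positions i, j >= 1 exchanges the entries of bot(x) in positions i and j
    ([bot_transp]).  Exchanging x_0 with x_j, when the entry 0 sits in position
    c >= 1, exchanges the entries of bot(x) in positions -c and j; this is a
    change of sign if j = c ([bot_transp0]).  Since the letter of bot(x) that
    replaces 0 is its only negative letter, comparing two entries of x agrees
    with comparing the corresponding entries of bot(x).  So a step x -> y gives
    a step bot(x) -> bot(y) ([bot_step]).  Conversely, every step u -> bot(y)
    comes from a step x -> y with bot(x) = u ([bot_step_inv]): a step that
    exchanges positions -i and j needs a negative entry of bot(y) in position i
    or j, hence one of those two positions holds the 0 of y.

    As bot is injective, it is therefore an embedding whose image is a down-set.
    The maximum of A_n is n ... 1 0, and its image is b_0, so the image is
    [id, b_0].  Finally, a signed permutation with at most one negative entry is
    turned back into a word on 0, ..., n by writing 0 for the negative entry and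
    putting its absolute value in front ([bot_onto]).

    The position form of the steps has the same proof in both types.  It needs
    no formula for the length: the pairs of positions inverted by w satisfy a
    cocycle identity ([invM]), the strong exchange property follows from it
    ([strong_exchange]), and this decides which of w and t w is longer. *)

(** * Groups of permutations of a ranked set *)

(** The exclusive or makes this symmetric in a and b for injective [rk] and f,
    and additive along compositions. *)
Definition inverts (X : finType) (rk : X -> nat) (f : X -> X) (a b : X) : bool :=
  (rk a < rk b) (+) (rk (f a) < rk (f b)).

Lemma invertsC (X : finType) (rk : X -> nat) (f : X -> X) (a b : X) :
  injective rk -> injective f -> inverts rk f b a = inverts rk f a b.
Proof.
move=> rk_inj f_inj; have [-> //|ab] := eqVneq a b.
have: rk a != rk b by rewrite (inj_eq rk_inj).
have: rk (f a) != rk (f b) by rewrite (inj_eq rk_inj) (inj_eq f_inj).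
by rewrite /inverts; lia.
Qed.

(** What is common to the word models of the two Coxeter groups: the group
    permutes a set of positions totally ordered by [rk], a reflection
    [refl a b] exchanges the positions a and b (and possibly others, as in
    type B), and the generators are the reflections of neighbouring positions.
    The pairs (a, b) play the role of roots: [reflJ] is equivariance,
    [inverts_refl] says that all pairs with the same reflection have the same
    sign behaviour, and [simple_inverts] that a simple reflection makes only
    its own root negative. *)
Record perm_model (gT : finGroupType) (S : {set gT}) := PermModel {
  pt : finType;
  act : gT -> {perm pt};
  rk : pt -> nat;
  refl : pt -> pt -> gT;
  actM : {morph act : u v / u * v};
  act_inj : injective act;
  rk_inj : injective rk;
  rk_pred : forall a, 0 < rk a -> exists b, rk a = (rk b).+1;
  reflL : forall a b, act (refl a b) a = b;
  reflK : forall a b, refl a b * refl a b = 1;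
  reflJ : forall a b u, refl (act u a) (act u b) = refl a b ^ u;
  inverts_refl : forall a b c d w, a != b -> c != d -> refl a b = refl c d ->
    inverts rk (act w) a b = inverts rk (act w) c d;
  simpleP : forall s,
    s \in S <-> exists a b, rk b = (rk a).+1 /\ s = refl a b;
  simple_inverts : forall a b c d, rk b = (rk a).+1 ->
    inverts rk (act (refl a b)) c d -> refl c d = refl a b
}.

(** By induction on the rank, f does not lower any rank; as f permutes X, the
    ranks and their images have the same sum, so no rank is raised either. *)
Lemma increasing_fixed (X : finType) (rk : X -> nat) (f : X -> X) :
    injective rk -> (forall a, 0 < rk a -> exists b, rk a = (rk b).+1) ->
    injective f -> (forall a b, rk b = (rk a).+1 -> rk (f a) < rk (f b)) ->
  forall a, f a = a.
Proof.
move=> rk_inj rk_pred f_inj f_incr.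
have le_rk a : rk a <= rk (f a).
  move: {2}(rk a) (erefl (rk a)) => k; elim: k a => [|k IHk] a Ea.
    by rewrite Ea.
  have [b Eb] : exists b, rk a = (rk b).+1 by apply: rk_pred; rewrite Ea.
  by have := IHk b; have := f_incr _ _ Eb; lia.
have /leqif_sum[_] (a : X) (_ : true) :
    rk a <= rk (f a) ?= iff (rk a == rk (f a)) by split.
rewrite (reindex_inj f_inj) eqxx => /esym/forallP/= eq_rk a.
by apply: rk_inj; rewrite (eqP (eq_rk a)).
Qed.

Section Model.
Variables (gT : finGroupType) (S : {set gT}) (M : perm_model S).
Implicit Types (a b c d : pt M) (s t u v w : gT) (k : nat).

Local Notation act := (@act _ _ M).
Local Notation rk := (@rk _ _ M).
Local Notation refl := (@refl _ _ M).
Local Notation inv w := (inverts rk (act w)).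
Local Notation len := (cox_length S).

Lemma act1 : act 1 = 1.
Proof. by apply: (@mulgI _ (act 1)); rewrite -actM !mulg1. Qed.

Lemma reflR a b : act (refl a b) b = a.
Proof.
by rewrite -{2}(reflL a b) -permM -actM reflK act1 perm1.
Qed.

Lemma reflC a b : refl b a = refl a b.
Proof. by have := reflJ a b (refl a b); rewrite reflL reflR conjgE mulKg. Qed.

Lemma invC w a b : inv w b a = inv w a b.
Proof. by apply: invertsC; [exact: rk_inj|exact: perm_inj]. Qed.

Lemma inv_neq w a b : inv w a b -> a != b.
Proof. by apply: contraTneq => ->; rewrite /inverts !ltnn. Qed.

(** The cocycle identity, from which all statements on lengths follow. *)
Lemma invM u v a b : inv (u * v) a b = inv u a b (+) inv v (act u a) (act u b).
Proof. by rewrite /inverts actM !permM addbA addbK. Qed.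

Lemma inv_refl a b : a != b -> inv (refl a b) a b.
Proof.
move=> ab; have: rk a != rk b by apply: contraNneq ab => /rk_inj->.
by rewrite /inverts reflL reflR; lia.
Qed.

Lemma adj_neq a b : rk b = (rk a).+1 -> a != b.
Proof. by move=> ab; apply/eqP => e; move: ab; rewrite e; lia. Qed.

Lemma simple_inv s a b : s \in S -> inv s a b = (a != b) && (refl a b == s).
Proof.
case/(simpleP M)=> c [d [cd ->]]; apply/idP/idP => [i_ab|/andP[ab /eqP <-]].
  by rewrite (inv_neq i_ab) (simple_inverts cd i_ab) eqxx.
exact: inv_refl.
Qed.

(** The generators generate: a nontrivial w inverts some pair of neighbours
    (a, b) by [increasing_fixed], and multiplying by s = [refl a b] strictly
    decreases the number of inverted pairs, because s maps the inverted pairs of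
    s w into those of w and misses (a, b). *)
Lemma word_exists w : exists k, w \in S ^+ k.
Proof.
pose N w := [set p | inv w p.1 p.2].
move: (ltnSn #|N w|); move: {2}_.+1 => k; elim: k w => // k IHk w ltNk.
have [-> | w1] := eqVneq w 1; first by exists 0; rewrite expg0 set11.
have [[a b] /andP[/eqP/= ab i_ab]|no_desc] :=
  pickP (fun p => (rk p.2 == (rk p.1).+1) && inv w p.1 p.2); last first.
  case/eqP: w1; apply: (@act_inj _ _ M); rewrite act1; apply/permP => a.
  rewrite perm1; apply: (increasing_fixed (@rk_inj _ _ M) (@rk_pred _ _ M)).
    exact: perm_inj.
  move=> c d cd; have:= no_desc (c, d).
  by rewrite /= /inverts cd eqxx ltnSn; lia.
have sS : refl a b \in S by apply/(simpleP M); exists a, b.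
set s := refl a b in sS.
have [j wj] : exists j, s * w \in S ^+ j.
  apply: IHk; rewrite -ltnS; apply: leq_trans ltNk.
  pose phi (p : pt M * pt M) := (act s p.1, act s p.2).
  have phi_inj : injective phi by move=> [c d] [c' d'] [/perm_inj-> /perm_inj->].
  rewrite -(card_imset _ phi_inj); apply: proper_card.
  apply/properP; split; last first.
    exists (a, b); first by rewrite inE.
    apply/imsetP=> -[[c d]]; rewrite inE /= => i_cd [Ea Eb].
    have Ec : c = b by rewrite -[c](permK (act s)) -Ea -{1}(reflR a b) permK.
    have Ed : d = a by rewrite -[d](permK (act s)) -Eb -{1}(reflL a b) permK.
    by move: i_cd; rewrite Ec Ed invM invC inv_refl ?adj_neq // reflL reflR i_ab.
  apply/subsetP=> _ /imsetP[[c d] + ->]; rewrite !inE /= invM simple_inv //.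
  have [//|cd] := eqVneq c d.
  case: eqP => //= E.
  have <- : inv w a b = inv w (act s c) (act s d); last by rewrite i_ab.
  apply: inverts_refl; rewrite ?(inj_eq perm_inj) ?(adj_neq ab) //.
  by rewrite reflJ E conjgE mulKg.
exists j.+1; have -> : w = s * (s * w) by rewrite mulgA reflK mul1g.
by rewrite expgS mem_mulg.
Qed.

Definition word_length w := ex_minn (word_exists w).

Lemma word_length_mem w : w \in S ^+ word_length w.
Proof. by rewrite /word_length; case: ex_minnP. Qed.

Lemma word_length_min w k : w \in S ^+ k -> word_length w <= k.
Proof. by rewrite /word_length; case: ex_minnP => j _ + /[dup] wk; apply. Qed.

(** All lengths below that of w occur, at suffixes of a shortest word for w,
    so there are more group elements than the length of w. This is why the
    bounded search in [cox_length] succeeds. *)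
Lemma word_length_card w : word_length w < #|gT|.
Proof.
have attained k : word_length w >= k -> exists v, word_length v = k.
  move E : (word_length w) => m; elim: m w E => [|m IHm] w E.
    by rewrite leqn0 => /eqP->; exists w.
  rewrite leq_eqVlt => /predU1P[->|]; first by exists w.
  rewrite ltnS; have := word_length_mem w; rewrite E expgS.
  case/mulsgP=> s v sS vm Ew; apply: (IHm v).
  apply/eqP; rewrite eqn_leq word_length_min //= -ltnS -E word_length_min //.
  by rewrite expgS Ew mem_mulg ?word_length_mem.
rewrite -[_.+1](size_iota 0) cardT -(size_map word_length).
apply: uniq_leq_size (iota_uniq _ _) _ => k; rewrite mem_iota /= add0n ltnS.
by case/attained=> v <-; apply: map_f; rewrite mem_enum.
Qed.

Lemma cox_lengthE w : len w = word_length w.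
Proof.
rewrite /cox_length; have lt_card := word_length_card w.
set P := fun k => _.
have hasP : has P (iota 0 #|gT|).
  apply/hasP; exists (word_length w); last exact: word_length_mem.
  by rewrite mem_iota.
apply/eqP; rewrite eqn_leq; apply/andP; split.
  rewrite leqNgt; apply/negP => /(before_find 0).
  by rewrite nth_iota // /P add0n word_length_mem.
apply: word_length_min; have := nth_find 0 hasP.
by rewrite nth_iota // -[X in _ < X](size_iota 0) -has_find.
Qed.

(** Reading the word s_1 ... s_k of w from the left, the cocycle identity shows
    that some prefix u = s_1 ... s_(i-1) carries (a, b) to a pair inverted by
    s_i, so [refl a b] = u s_i u^-1, and multiplying by it deletes s_i. *)
Lemma strong_exchange k w a b :
  w \in S ^+ k -> inv w a b -> exists2 j, j < k & refl a b * w \in S ^+ j.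
Proof.
elim: k w a b => [|k IHk] w a b.
  by rewrite expg0 => /set1P->; rewrite /inverts act1 !perm1 addbb.
rewrite expgS => /mulsgP[s v sS vk ->]; rewrite invM simple_inv //.
have [<-|ab] := eqVneq a b; first by rewrite /inverts !ltnn.
case: (refl a b =P s) => [<- _|_ /= i_v].
  by exists k; rewrite ?ltnSn // mulgA reflK mul1g.
have [j ltjk vj] := IHk _ _ _ vk i_v.
exists j.+1; first by [].
have -> : refl a b * (s * v) = s * (refl (act s a) (act s b) * v).
  by rewrite reflJ conjgE !mulgA mulgV mul1g.
by rewrite expgS mem_mulg.
Qed.

Lemma len_refl_lt w a b : inv w a b -> len (refl a b * w) < len w.
Proof.
move=> i_w; rewrite !cox_lengthE.
have [j] := strong_exchange (word_length_mem w) i_w.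
by move=> ltj /word_length_min; lia.
Qed.

(** If (a, b) is not inverted by w, it is inverted by t w for t = [refl a b],
    and [len_refl_lt] applies to t w. *)
Lemma len_refl w a b : a != b -> (len w < len (refl a b * w)) = ~~ inv w a b.
Proof.
move=> ab; case i_w: (inv w a b) => /=.
  by apply/negbTE; rewrite -leqNgt ltnW ?len_refl_lt.
rewrite -{1}[w]mul1g -(reflK a b) -mulgA len_refl_lt // invM inv_refl //.
by rewrite reflL reflR invC i_w.
Qed.

(** The conjugating element is the prefix found in [strong_exchange]; applied to
    w = [refl a b], this shows that [refl a b] is a reflection. *)
Lemma inv_conj_simple k w a b : w \in S ^+ k -> inv w a b ->
  exists u, refl a b ^ u \in S.
Proof.
elim: k w a b => [|k IHk] w a b.
  by rewrite expg0 => /set1P->; rewrite /inverts act1 !perm1 addbb.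
rewrite expgS => /mulsgP[s v sS vk ->]; rewrite invM simple_inv //.
have [<-|ab] := eqVneq a b; first by rewrite /inverts !ltnn.
case: (refl a b =P s) => [-> _|_ /= i_v]; first by exists 1; rewrite conjg1.
have [u] := IHk _ _ _ vk i_v; rewrite reflJ -conjgM; by exists (s * u).
Qed.

Lemma reflectionsP t :
  reflect (exists a b, a != b /\ t = refl a b) (t \in reflections S).
Proof.
apply: (iffP imset2P) => [[s u /(simpleP M)[a [b [ab ->]]] _ ->]|].
  by exists (act u a), (act u b); rewrite reflJ (inj_eq perm_inj) adj_neq.
case=> a [b [ab ->]].
have [k rk] := word_exists (refl a b).
have [u uS] := inv_conj_simple rk (inv_refl ab).
by exists (refl a b ^ u) u^-1; rewrite ?inE // conjgK.
Qed.

(** Left multiplication by [refl a b] is right multiplication by a conjugate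
    of it, so it does not matter that [bruhat_step] multiplies on the right. *)
Lemma bruhat_stepP u w :
  reflect (exists a b, [/\ rk a < rk b, rk (act u a) < rk (act u b)
                         & w = refl a b * u])
          (bruhat_step S u w).
Proof.
apply: (iffP andP) => [[/exists_inP[t tR /eqP Ew]]|[a [b [lt_ab lt_uab ->]]]].
  have /reflectionsP[a [b [ab Et]]] : t ^ u^-1 \in reflections S.
    by rewrite /reflections -(class_supportGidr S (in_setT u^-1)) memJ_conjg.
  have -> : w = refl a b * u by rewrite -Et conjgE invgK Ew !mulgA mulgKV.
  rewrite len_refl // => no_inv.
  wlog lt_ab : a b ab {Et} no_inv / rk a < rk b => [IH|].
    have [|le_ab] := ltnP (rk a) (rk b); first exact: IH.
    rewrite -reflC; apply: IH; rewrite 1?eq_sym 1?invC //.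
    by rewrite ltn_neqAle le_ab andbT (inj_eq (@rk_inj _ _ M)) eq_sym.
  exists a, b; split=> //; move: no_inv; rewrite /inverts lt_ab.
  by rewrite addTb negbK.
have ab : a != b by apply: contraTneq lt_ab => ->; rewrite ltnn.
rewrite len_refl // /inverts lt_ab lt_uab; split=> //.
apply/exists_inP; exists (refl a b ^ u).
  apply/reflectionsP; exists (act u a), (act u b).
  by rewrite reflJ (inj_eq perm_inj).
by rewrite conjgE !mulgA mulgV mul1g.
Qed.

End Model.

(** * Bruhat steps on words and on signed words *)

Section TypeA.
Variable n : nat.
Implicit Types (a b c d : 'I_n.+1) (x : An n).

(** The product in [An n] applies the left factor first, so [transp_A a b * x]
    exchanges the entries of the word x in positions a and b. *)
Definition transp_A a b : An n := tperm a b.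

Lemma simples_AP (s : An n) :
  s \in simples_A n <->
  exists a b : 'I_n.+1, b = a.+1 :> nat /\ s = transp_A a b.
Proof.
split=> [/imsetP[i _ ->]|[a [b [ab ->]]]].
  exists (widen_ord (leqnSn n) i), (lift ord0 i); split=> //.
have lt_an : a < n by have := ltn_ord b; lia.
apply/imsetP; exists (Ordinal lt_an) => //; rewrite /transp_A /simple_A.
by congr tperm; apply: val_inj.
Qed.

Lemma transp_A_inverts a b c d (x : An n) : a != b -> c != d ->
  transp_A a b = transp_A c d ->
  inverts (@nat_of_ord _) x a b = inverts (@nat_of_ord _) x c d.
Proof.
move=> ab cd E.
have := congr1 (fun f : {perm 'I_n.+1} => f c) E; rewrite /= tpermL.
have neq (e f : 'I_n.+1) : e != f -> (e != f :> nat) && (x e != x f :> nat).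
  by move=> ef; rewrite !(inj_eq val_inj) (inj_eq perm_inj) ef.
case: tpermP => [-> <- // | -> <- | _ _ e].
  by have := neq _ _ ab; rewrite /inverts; lia.
by rewrite e eqxx in cd.
Qed.

Lemma transp_A_simple a b c d : b = a.+1 :> nat ->
  inverts (@nat_of_ord _) (transp_A a b) c d -> transp_A c d = transp_A a b.
Proof.
move=> ab; rewrite /inverts /transp_A.
have eqV e f : (e : 'I_n.+1) <> f -> e <> f :> nat by move=> ef /val_inj.
by case: tpermP => [->|->|/eqV ca /eqV cb]; case: tpermP => [->|->|/eqV da /eqV db];
  rewrite // 1?tpermC //; lia.
Qed.

Definition model_A : perm_model (simples_A n).
Proof.
apply: (@PermModel _ _ 'I_n.+1 (fun x => x) (@nat_of_ord _) transp_A) => //.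
- exact: val_inj.
- by move=> a a0; exists (inord a.-1); rewrite inordK prednK // ltnW.
- exact: tpermL.
- exact: tperm2.
- by move=> a b u; rewrite /transp_A tpermJ.
- by move=> a b c d w; apply: transp_A_inverts.
- exact: simples_AP.
- exact: transp_A_simple.
Defined.

Lemma bruhat_step_A x y :
  reflect (exists a b, [/\ a < b, x a < x b & y = transp_A a b * x])
          (bruhat_step (simples_A n) x y).
Proof. exact: (bruhat_stepP model_A). Qed.

End TypeA.

Section TypeB.
Variable n : nat.
Implicit Types (a b c d : letter n) (u w : Bn n).
Local Notation neg := (@neg_letter n).

(** The rank of a letter in -n < ... < -1 < 1 < ... < n, counted from 0. *)
Definition rk_B a : nat := if a.2 then n - a.1.+1 else n + a.1.

Lemma rk_B_neg a : (rk_B a + rk_B (neg a)).+1 = n.*2.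
Proof. by case: a => i [] /=; rewrite /rk_B /=; have := ltn_ord i; lia. Qed.

Lemma rk_B_inj : injective rk_B.
Proof.
move=> [i b] [j c]; rewrite /rk_B /= => e.
have := ltn_ord i; have := ltn_ord j.
by case: b c e => [] [] e li lj; try lia; congr pair; apply: val_inj => /=; lia.
Qed.

Lemma sgval_neg w a : sgval w (neg a) = neg (sgval w a).
Proof.
by have /cent1P/permP/(_ a) := subgP w; rewrite !permM !permE.
Qed.

(** If b = -a, the two transpositions below coincide and would cancel, hence
    the separate case, which is the sign change at a. *)
Definition transp_B_perm a b : {perm letter n} :=
  if b == neg a then tperm a b else tperm a b * tperm (neg a) (neg b).

Lemma neg_eq a b : (neg a == b) = (a == neg b).
Proof. exact: (can2_eq (@neg_letterK n) (@neg_letterK n)). Qed.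

Lemma neg_neq a : (a == neg a) = false.
Proof. by case: a => i b; apply/eqP => -[]; case: b. Qed.

Lemma transp_B_permE a b c : transp_B_perm a b c =
  if c == a then b else if c == b then a else
  if c == neg a then neg b else if c == neg b then neg a else c.
Proof.
rewrite /transp_B_perm; case: (b =P neg a) => [->|/eqP bna].
  rewrite neg_letterK; case: tpermP => [->|->|/eqP/negPf-> /eqP/negPf-> //].
    by rewrite eqxx.
  by rewrite eq_sym neg_neq eqxx.
rewrite permM; case: (tpermP a b c) => [->|->|/eqP/negPf-> /eqP/negPf->].
- by rewrite eqxx tpermD // eq_sym ?neg_neq.
- rewrite eqxx tpermD ?neg_eq ?neg_neq //.
  by case: eqP => [->|].
- by rewrite permE.
Qed.

Lemma transp_B_permJ a b (s : {perm letter n}) :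
    (forall c, s (neg c) = neg (s c)) ->
  transp_B_perm a b ^ s = transp_B_perm (s a) (s b).
Proof.
move=> sN; rewrite /transp_B_perm -sN (inj_eq perm_inj).
by case: ifP; rewrite ?conjMg !tpermJ ?sN.
Qed.

Lemma transp_B_permN a b :
  transp_B_perm (neg a) (neg b) = transp_B_perm a b.
Proof.
rewrite /transp_B_perm !neg_letterK neg_eq.
case: eqP => [->|/eqP bna]; first by rewrite neg_letterK tpermC.
have: tperm a b ^ tperm (neg a) (neg b) = tperm a b.
  by rewrite tpermJ !tpermD // ?neg_eq ?neg_neq // eq_sym neg_eq.
by move/conjg_fixP/commgP=> ->.
Qed.

Lemma transp_B_cent a b : transp_B_perm a b \in 'C[neg_perm n].
Proof.
apply/cent1P; apply/commgP/conjg_fixP; rewrite transp_B_permJ; last first.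
  by move=> c; rewrite !permE.
by rewrite !permE transp_B_permN.
Qed.

Definition transp_B a b : Bn n := Subg (transp_B_cent a b).

Lemma transp_BE a b c : sgval (transp_B a b) c =
  if c == a then b else if c == b then a else
  if c == neg a then neg b else if c == neg b then neg a else c.
Proof. exact: transp_B_permE. Qed.

Lemma transp_BL a b : sgval (transp_B a b) a = b.
Proof. by rewrite transp_BE eqxx. Qed.

Lemma transp_BR a b : sgval (transp_B a b) b = a.
Proof. by rewrite transp_BE eqxx; case: eqP => [->|]. Qed.

Lemma transp_BK a b : transp_B a b * transp_B a b = 1.
Proof.
apply/val_inj/permP => c; rewrite /= permM perm1 -![transp_B_perm a b]/(sgval (transp_B a b)).
rewrite (transp_BE a b c).
case: eqP => [->|/eqP/negPf ca]; first by rewrite transp_BR.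
case: eqP => [->|/eqP/negPf cb]; first by rewrite transp_BL.
case: eqP => [->|/eqP/negPf ca']; first by rewrite sgval_neg transp_BR.
case: eqP => [->|/eqP/negPf cb']; first by rewrite sgval_neg transp_BL.
by rewrite transp_BE ca cb ca' cb'.
Qed.

Lemma transp_BN a b : transp_B (neg a) (neg b) = transp_B a b.
Proof. exact/val_inj/transp_B_permN. Qed.

Lemma transp_BC a b : transp_B b a = transp_B a b.
Proof.
apply/val_inj; rewrite /= /transp_B_perm -neg_eq [_ == b]eq_sym.
by case: eqP => _; rewrite ![tperm b a]tpermC // (tpermC (neg b)).
Qed.

Lemma inverts_B_neg w a b : 
  inverts rk_B (sgval w) (neg a) (neg b) = inverts rk_B (sgval w) a b.
Proof.
rewrite -[RHS]invertsC; [|exact: rk_B_inj|exact: perm_inj].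
rewrite /inverts !sgval_neg.
have := (rk_B_neg a, rk_B_neg b, rk_B_neg (sgval w a), rk_B_neg (sgval w b)).
by case=> [[[]]]; lia.
Qed.

(** The pairs with the same reflection as (a, b) are (a, b), (-b, -a) and their
    reversals, and negation reverses the order of letters. *)
Lemma transp_B_inverts a b c d w : a != b -> c != d ->
  transp_B a b = transp_B c d ->
  inverts rk_B (sgval w) a b = inverts rk_B (sgval w) c d.
Proof.
move=> ab cd E.
have Ed : sgval (transp_B a b) c = d by rewrite E transp_BE eqxx.
move: Ed cd; rewrite transp_BE.
case: eqP => [-> <- //|_].
case: eqP => [-> <- _|_].
  by rewrite invertsC //; [exact: rk_B_inj|exact: perm_inj].
case: eqP => [-> <- _|_]; first by rewrite inverts_B_neg.
case: eqP => [-> <- _|_ ->]; last by rewrite eqxx.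
rewrite inverts_B_neg.
by rewrite invertsC //; [exact: rk_B_inj|exact: perm_inj].
Qed.

(** If a and b are neighbours, so are -b and -a, and exchanging neighbours
    changes the relative order of no other pair. *)
Lemma transp_B_simple a b c d : rk_B b = (rk_B a).+1 ->
  inverts rk_B (sgval (transp_B a b)) c d -> transp_B c d = transp_B a b.
Proof.
move=> ab; rewrite /inverts !transp_BE.
have := (rk_B_neg a, rk_B_neg b); case=> na nb.
have neq e f : e <> f -> rk_B e <> rk_B f by move=> ef /rk_B_inj.
case: (c =P a) => [?|/neq ca]; last case: (c =P b) => [?|/neq cb];
  last case: (c =P neg a) => [?|/neq ca']; last case: (c =P neg b) => [?|/neq cb'].
all: case: (d =P a) => [?|/neq da]; last case: (d =P b) => [?|/neq db];
  last case: (d =P neg a) => [?|/neq da']; last case: (d =P neg b) => [?|/neq db'].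
all: subst; rewrite ?transp_BN 1?[transp_B b a]transp_BC //; lia.
Qed.

Lemma simple_B_0 (i : 'I_n) : i = 0 :> nat ->
  simple_B i = transp_B (i, true) (i, false).
Proof.
move=> i0; apply: one_line_inj => j.
rewrite one_line_of_word /one_line transp_BE /simple_B_word i0 eqxx.
rewrite !xpair_eqE andbF andbT /=.
by case: eqP => [->|].
Qed.

Lemma simple_B_S (i k : 'I_n) : i = k.+1 :> nat ->
  simple_B i = transp_B (k, false) (i, false).
Proof.
move=> ik; apply: one_line_inj => j.
rewrite one_line_of_word /one_line transp_BE /simple_B_word {1}ik /=.
have -> : ord_pred i = k.
  by apply: val_inj; rewrite /= ik addSn /= modnDr modn_small.
rewrite !xpair_eqE !andbF !andbT /=.
case: tpermP => [->|->|/eqP/negPf-> /eqP/negPf->]; rewrite ?eqxx //.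
by case: eqP => [->|].
Qed.

Lemma simples_BP (s : Bn n) :
  s \in simples_B n <->
  exists a b, rk_B b = (rk_B a).+1 /\ s = transp_B a b.
Proof.
(* Neighbouring letters are -(k+1), -k, or -1, 1, or k, k+1; the first kind has
   the same reflection as the third. *)
split=> [/imsetP[i _ ->]|[[k []] [[l []] [/= ab ->]]]].
- have [i0|i0] := posnP i.
    exists (i, true), (i, false); split; last exact: simple_B_0.
    by rewrite /rk_B /= i0; have := ltn_ord i; lia.
  have ltin : i.-1 < n by have := ltn_ord i; lia.
  exists (Ordinal ltin, false), (i, false); split; last first.
    by apply: simple_B_S; rewrite /= prednK.
  by rewrite /rk_B /=; lia.
- rewrite -transp_BN /= transp_BC -simple_B_S ?imset_f //.
  by move: ab; rewrite /rk_B /=; have := ltn_ord k; have := ltn_ord l; lia.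
- move: ab; rewrite /rk_B /= => ab.
  have := ltn_ord k; have := ltn_ord l => ltl ltk.
  have -> : l = k by apply: val_inj => /=; lia.
  by rewrite -simple_B_0 ?imset_f //; lia.
- by move: ab; rewrite /rk_B /=; have := ltn_ord k; have := ltn_ord l; lia.
- rewrite -simple_B_S ?imset_f //.
  by move: ab; rewrite /rk_B /=; lia.
Qed.

Lemma rk_B_pred a : 0 < rk_B a -> exists b, rk_B a = (rk_B b).+1.
Proof.
case: a => i [] /=; rewrite /rk_B /= => a0; have lti := ltn_ord i.
  have ltin : i.+1 < n by lia.
  by exists (Ordinal ltin, true) => /=; lia.
have [i0|i0] := posnP i; first by exists (i, true) => /=; lia.
have ltin : i.-1 < n by lia.
by exists (Ordinal ltin, false) => /=; lia.
Qed.

Definition model_B : perm_model (simples_B n).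
Proof.
apply: (@PermModel _ _ (letter n) (fun w => sgval w) rk_B transp_B).
- by [].
- exact: val_inj.
- exact: rk_B_inj.
- exact: rk_B_pred.
- exact: transp_BL.
- exact: transp_BK.
- move=> a b u; apply/val_inj; rewrite /= -transp_B_permJ //.
  exact: sgval_neg.
- exact: transp_B_inverts.
- exact: simples_BP.
- exact: transp_B_simple.
Defined.

Lemma bruhat_step_B u w :
  reflect (exists a b, [/\ rk_B a < rk_B b, rk_B (sgval u a) < rk_B (sgval u b)
                         & w = transp_B a b * u])
          (bruhat_step (simples_B n) u w).
Proof. exact: (bruhat_stepP model_B). Qed.

End TypeB.

(** * The bottom map on Bruhat steps *)

Section Bot.
Variable n : nat.
Implicit Types (x y : An n) (i j k l c : 'I_n) (a b : letter n) (u w : Bn n).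
Local Notation neg := (@neg_letter n).
Local Notation up := (lift (@ord0 n)).
Local Arguments bot : simpl never.
Local Arguments sgval : simpl never.

Lemma one_line_bot_pos x i k : x (up i) = up k -> one_line (bot x) i = (k, false).
Proof. by move=> E; rewrite one_line_of_word /bot_word E liftK. Qed.

Lemma one_line_bot_neg x i k :
  x (up i) = ord0 -> x ord0 = up k -> one_line (bot x) i = (k, true).
Proof.
by move=> Ei E0; rewrite one_line_of_word /bot_word Ei E0 unlift_none liftK.
Qed.

Lemma up_neq0 i : (up i == ord0) = false.
Proof. exact/negbTE. Qed.

Lemma ord0_or_up (p : 'I_n.+1) : p = ord0 \/ exists i, p = up i.
Proof. by case: (unliftP ord0 p) => [i|]; [right; exists i|left]. Qed.

Lemma first_letter x c : x (up c) = ord0 -> exists k, x ord0 = up k.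
Proof.
move=> Ec; case: (ord0_or_up (x ord0)) => // E0.
by have /perm_inj/eqP : x (up c) = x ord0; rewrite ?Ec ?E0 // up_neq0.
Qed.

Variant bot_spec x i : letter n -> Prop :=
| BotPos k of x (up i) = up k : bot_spec x i (k, false)
| BotNeg k of x (up i) = ord0 & x ord0 = up k : bot_spec x i (k, true).

Lemma botP x i : bot_spec x i (one_line (bot x) i).
Proof.
case: (ord0_or_up (x (up i))) => [Ei|[k Ei]].
  have [k E0] := first_letter Ei.
  by rewrite (one_line_bot_neg Ei E0); constructor.
by rewrite (one_line_bot_pos Ei); constructor.
Qed.

Lemma sgvalM u w a : sgval (u * w) a = sgval w (sgval u a).
Proof. by rewrite /= permM. Qed.

Lemma sgval_pos w i : sgval w (i, false) = one_line w i. Proof. by []. Qed.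

Lemma sgval_neg_pos w i : sgval w (i, true) = neg (one_line w i).
Proof. by rewrite -sgval_neg. Qed.

(** The first entry is not affected, so neither is the letter that replaces
    0. *)
Lemma bot_transp x i j :
  bot (transp_A (up i) (up j) * x) = transp_B (i, false) (j, false) * bot x.
Proof.
set y : An n := _ * x.
apply: one_line_inj => k; rewrite -[RHS]sgval_pos sgvalM transp_BE.
rewrite !xpair_eqE !andbT !andbF.
have -> : (if k == i then (j, false) else if k == j then (i, false)
  else (k, false)) = (tperm i j k, false).
  case: tpermP => [->|->|/eqP/negPf-> /eqP/negPf->]; rewrite ?eqxx //.
  by case: eqP => [->|].
have Ek : y (up k) = x (up (tperm i j k)).
  rewrite permM /transp_A; congr (x _).
  case: (tpermP i j k) => [->|->|/eqP ki /eqP kj]; rewrite ?tpermL ?tpermR //.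
  by rewrite tpermD // (inj_eq lift_inj) eq_sym.
have E0 : y ord0 = x ord0.
  by rewrite permM tpermD ?up_neq0.
rewrite sgval_pos; case: (botP x) => l El.
  by rewrite (@one_line_bot_pos _ _ l) // Ek.
by move=> E0'; rewrite (@one_line_bot_neg _ _ l) ?Ek ?E0.
Qed.

(** Write x_0 = m. If j = c, the entry 0 moves to the front and -m becomes m.
    Otherwise x_j = l moves to the front, so -m in position c becomes -l, and l
    in position j becomes m: the exchange of the entries m and l in positions -c
    and j, together with its mirror image. *)
Lemma bot_transp0 x c j : x (up c) = ord0 ->
  bot (transp_A ord0 (up j) * x) = transp_B (c, true) (j, false) * bot x.
Proof.
move=> Ec; have [m E0] := first_letter Ec.
set y : An n := _ * x.
have Ey0 : y ord0 = x (up j) by rewrite permM tpermL.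
have Eyj : y (up j) = up m by rewrite permM tpermR.
have Ey k : k != j -> y (up k) = x (up k).
  by move=> kj; rewrite permM tpermD // (inj_eq lift_inj) eq_sym.
apply: one_line_inj => k; rewrite -[RHS]sgval_pos sgvalM transp_BE.
rewrite !xpair_eqE /= !andbF !andbT.
have [->|kj] := eqVneq k j.
  by rewrite (one_line_bot_pos Eyj) sgval_neg_pos (one_line_bot_neg Ec E0).
have [Ekc|kc] := eqVneq k c.
  rewrite Ekc /= sgval_neg_pos; case: (botP x) => l El.
    by rewrite (@one_line_bot_neg _ _ l) // ?Ey0 // Ey // -Ekc.
  have: x (up j) = x (up c) by rewrite El Ec.
  by move/perm_inj/lift_inj => jc; rewrite jc -Ekc eqxx in kj.
rewrite sgval_pos; case: (botP x) => l El.
  by rewrite (@one_line_bot_pos _ _ l) // Ey.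
have: x (up k) = x (up c) by rewrite El Ec.
by move/perm_inj/lift_inj => ekc; rewrite ekc eqxx in kc.
Qed.

(** The letter replacing 0 is smaller than all others, as 0 was. *)
Lemma rk_bot_lt x i j :
  (rk_B (sgval (bot x) (i, false)) < rk_B (sgval (bot x) (j, false)))
    = (x (up i) < x (up j)).
Proof.
rewrite !sgval_pos.
case: (botP x i) => k Ei; case: (botP x j) => l Ej; rewrite Ei Ej /rk_B /= /bump /=;
  have := ltn_ord k; have := ltn_ord l; try lia.
by move=> _ _ -> /lift_inj->; rewrite !ltnn.
Qed.

(** In position -c, bot(x) has the letter x_0, and in position c the letter
    -x_0, so j = c is no exception. *)
Lemma rk_bot_lt0 x c j : x (up c) = ord0 ->
  (rk_B (sgval (bot x) (j, false)) < rk_B (sgval (bot x) (c, true)))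
    = (x (up j) < x ord0).
Proof.
move=> Ec; have [m E0] := first_letter Ec.
rewrite sgval_neg_pos (one_line_bot_neg Ec E0) sgval_pos.
by case: botP => [k Ej|k Ej E0']; rewrite Ej E0 /rk_B /= /bump /=; have := ltn_ord k; lia.
Qed.

Lemma bot_step x y : bruhat_step (simples_A n) x y ->
  bruhat_step (simples_B n) (bot x) (bot y).
Proof.
case/bruhat_step_A=> p [q [lt_pq lt_xpq Ey]]; apply/bruhat_step_B.
have Ex : x = transp_A p q * y by rewrite Ey mulgA tperm2 mul1g.
case: (ord0_or_up q) lt_pq lt_xpq Ey Ex => [-> //|[j ->]].
case: (ord0_or_up p) => [->|[i ->]] lt_pq lt_xpq Ey Ex.
  have lt_y : y (up j) < y ord0 by rewrite Ey !permM tpermL tpermR.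
  (* y_0 > y_j, so 0 is not the first entry of y. *)
  have [c Ec] : exists c, y (up c) = ord0.
    case: (ord0_or_up (y^-1 ord0)) => [E|[c E]]; last by exists c; rewrite -E permKV.
    by rewrite -E permKV in lt_y.
  have Ebx : bot x = transp_B (c, true) (j, false) * bot y.
    by rewrite -bot_transp0 // -Ex.
  exists (c, true), (j, false); split.
  - by rewrite /rk_B /=; have := ltn_ord c; lia.
  - rewrite Ebx !sgvalM; move: lt_y; rewrite -(rk_bot_lt0 _ Ec).
    by rewrite transp_BL transp_BR.
  - by rewrite Ebx mulgA transp_BK mul1g.
exists (i, false), (j, false); split; last by rewrite -bot_transp -Ey.
  by rewrite /rk_B /= ltn_add2l; move: lt_pq; rewrite /= /bump /=; lia.
by rewrite rk_bot_lt.
Qed.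

Lemma bot_descent0 y c j : y (up c) = ord0 ->
    rk_B (sgval (bot y) (j, false)) < rk_B (sgval (bot y) (c, true)) ->
  exists2 x, transp_B (c, true) (j, false) * bot y = bot x
           & bruhat_step (simples_A n) x y.
Proof.
move=> Ec; rewrite (rk_bot_lt0 _ Ec) => lt_y.
exists (transp_A ord0 (up j) * y); first by rewrite (bot_transp0 _ Ec).
apply/bruhat_step_A; exists ord0, (up j); split=> //.
  by rewrite !permM tpermL tpermR.
by rewrite mulgA tperm2 mul1g.
Qed.

(** Up to replacing (a, b) by (-b, -a), which has the same reflection, either
    both positions are positive, or they are -i and j with the entry 0 of y in
    position i: bot(y) decreases from position -i to j, so its entries in i and
    j are not both positive. *)
Lemma bot_descent y a b :
    rk_B a < rk_B b -> rk_B (sgval (bot y) b) < rk_B (sgval (bot y) a) ->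
  exists2 x, transp_B a b * bot y = bot x & bruhat_step (simples_A n) x y.
Proof.
have flip e f : rk_B e < rk_B f -> rk_B (neg f) < rk_B (neg e).
  by have := rk_B_neg e; have := rk_B_neg f; lia.
have pos i j : rk_B (i, false) < rk_B (j, false) ->
    rk_B (sgval (bot y) (j, false)) < rk_B (sgval (bot y) (i, false)) ->
  exists2 x, transp_B (i, false) (j, false) * bot y = bot x
           & bruhat_step (simples_A n) x y.
  rewrite rk_bot_lt {1 2}/rk_B /= ltn_add2l => lt_ij lt_y.
  exists (transp_A (up i) (up j) * y); first by rewrite bot_transp.
  apply/bruhat_step_A; exists (up i), (up j); split=> //.
    by rewrite !permM tpermL tpermR.
  by rewrite mulgA tperm2 mul1g.
case: a b => [i []] [j []] lt_ab lt_y.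
- rewrite -transp_BN transp_BC; apply: pos; first exact: flip lt_ab.
  by have := flip _ _ lt_y; rewrite -!sgval_neg.
- case: (ord0_or_up (y (up i))) => [Ei|[k Ei]]; first exact: bot_descent0.
  have lt_y' := flip _ _ lt_y; rewrite -!sgval_neg in lt_y'.
  rewrite -transp_BN transp_BC; apply: bot_descent0 => //.
  move: lt_y; rewrite sgval_neg_pos (one_line_bot_pos Ei) sgval_pos; case: botP => // l _.
  by rewrite /rk_B /=; have := ltn_ord k; lia.
- by move: lt_ab; rewrite /rk_B /=; have := ltn_ord j; lia.
- exact: pos.
Qed.

Lemma bot_step_inv u y : bruhat_step (simples_B n) u (bot y) ->
  exists2 x, u = bot x & bruhat_step (simples_A n) x y.
Proof.
case/bruhat_step_B=> a [b [lt_ab lt_uab Ey]].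
have -> : u = transp_B a b * bot y by rewrite Ey mulgA transp_BK mul1g.
apply: bot_descent => //; rewrite Ey !sgvalM.
by rewrite transp_BL transp_BR.
Qed.

(** bot(x) determines all entries of x but the first, and hence the first. *)
Lemma bot_inj : injective (@bot n).
Proof.
move=> x y E; pose v (a : letter n) := if a.2 then ord0 else up a.1.
have Ev (z : An n) i : z (up i) = v (one_line (bot z) i) by case: botP => [k ->|k ->].
have Eup i : x (up i) = y (up i) by rewrite !Ev E.
suff E0 : x ord0 = y ord0.
  by apply/permP => p; case: (ord0_or_up p) => [->|[i ->]].
rewrite -(permKV x (y ord0)); case: (ord0_or_up (x^-1 (y ord0))) => [->//|[i Ei]].
have: y (up i) = y ord0 by rewrite -Eup -Ei permKV.
by move/perm_inj/eqP; rewrite up_neq0.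
Qed.

(** A chain of steps that ends at bot(y) lifts step by step from its top, by
    [bot_step_inv]. *)
Lemma bot_bruhat_inv u y : bruhat (simples_B n) u (bot y) ->
  exists2 x, u = bot x & bruhat (simples_A n) x y.
Proof.
case/connectP=> p; elim: p u => [|v p IHp] u /= => [_ <-|/andP[uv vp] Ey].
  by exists y; rewrite // /bruhat connect0.
have [z Ez zy] := IHp _ vp Ey; move: uv; rewrite Ez => /bot_step_inv[x -> xz].
by exists x => //; exact: connect_trans (connect1 xz) zy.
Qed.

Lemma bot_bruhat x y :
  bruhat (simples_A n) x y <-> bruhat (simples_B n) (bot x) (bot y).
Proof.
split=> [/connectP[p]|/bot_bruhat_inv[z /bot_inj->]] //.
elim: p x => [|z p IHp] x /= => [_ ->|/andP[xz zp] Ey].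
  exact: connect0.
exact: connect_trans (connect1 (bot_step xz)) (IHp _ zp Ey).
Qed.

(** * The image *)

Lemma num_neg_le1P w :
  reflect (forall i j, (one_line w i).2 -> (one_line w j).2 -> i = j)
          (num_neg w <= 1).
Proof.
apply: (iffP card_le1_eqP) => H i j; last first.
  by rewrite !inE => wi wj; apply: H.
by move=> wi wj; apply: H; rewrite inE.
Qed.

Lemma num_neg_bot x : num_neg (bot x) <= 1.
Proof.
apply/num_neg_le1P => i j; case: botP => // k Ei _; case: botP => // l Ej _ _ _.
by apply/(@lift_inj _ ord0)/(@perm_inj _ x); rewrite Ei Ej.
Qed.

Lemma one_line_fst_inj w i j : (one_line w i).1 = (one_line w j).1 -> i = j.
Proof.
move=> e; have [|d] := eqVneq (one_line w i).2 (one_line w j).2 => [e2|].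
  have /perm_inj[//] : sgval w (i, false) = sgval w (j, false).
  by rewrite !sgval_pos (surjective_pairing (one_line w i)) e e2 -surjective_pairing.
have /perm_inj[//] : sgval w (i, false) = sgval w (j, true).
rewrite sgval_neg_pos sgval_pos /neg_letter -e -(negbK (one_line w j).2).
by rewrite [LHS]surjective_pairing; congr pair; case: (_.2) (_.2) d => [] [].
Qed.

(** The inverse of bot: 0 is written for the negative letter, if there is one,
    and its absolute value goes to the front. *)
Definition unbot_fun w (p : 'I_n.+1) : 'I_n.+1 :=
  if unlift ord0 p is Some i then
    if (one_line w i).2 then ord0 else up (one_line w i).1
  else if [pick i | (one_line w i).2] is Some i then up (one_line w i).1
  else ord0.

Lemma unbot_fun_inj w : num_neg w <= 1 -> injective (unbot_fun w).
Proof.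
move=> /num_neg_le1P w1 p q; rewrite /unbot_fun.
case: unliftP => [i ->|->]; case: unliftP => [j ->|->] //.
- case: ifP => wi; case: ifP => wj E.
  + by rewrite (w1 i j).
  + by have := up_neq0 (one_line w j).1; rewrite -E.
  + by have := up_neq0 (one_line w i).1; rewrite E.
  + by move/lift_inj/one_line_fst_inj: E => ->.
- case: pickP => [j wj|w0]; case: ifP => wi E.
  + by have := up_neq0 (one_line w j).1; rewrite -E.
  + by move/lift_inj/one_line_fst_inj: E wi => ->; rewrite wj.
  + by rewrite w0 in wi.
  + by have := up_neq0 (one_line w i).1; rewrite E.
- case: pickP => [i wi|w0]; case: ifP => wj E.
  + by have := up_neq0 (one_line w i).1; rewrite E.
  + by move/lift_inj/one_line_fst_inj: E wj => <-; rewrite wi.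
  + by rewrite w0 in wj.
  + by have := up_neq0 (one_line w j).1; rewrite -E.
Qed.

Lemma bot_onto w : num_neg w <= 1 -> exists x, w = bot x.
Proof.
move=> w1; exists (perm (unbot_fun_inj w1)); apply: one_line_inj => i.
have Ei : perm (unbot_fun_inj w1) (up i) =
    if (one_line w i).2 then ord0 else up (one_line w i).1.
  by rewrite permE /unbot_fun liftK.
rewrite [LHS]surjective_pairing; case wi: (_.2) Ei => Ei.
  rewrite (@one_line_bot_neg _ _ (one_line w i).1) //.
  rewrite permE /unbot_fun unlift_none; case: pickP => [j wj|/(_ i)]; last by rewrite wi.
  by have /num_neg_le1P/(_ i j wi wj)-> := w1.
by rewrite (@one_line_bot_pos _ _ (one_line w i).1).
Qed.

Definition rev_A : An n := perm (@rev_ord_inj n.+1).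

Lemma bot_rev : bot rev_A = b0 n.
Proof.
apply: one_line_inj => i; rewrite [RHS]one_line_of_word /b0_word.
have Ei : rev_A (up i) = n - i.+1 :> nat by rewrite permE /= subSS.
case: eqP => [En|En].
  apply: one_line_bot_neg; apply: val_inj; first by apply: (etrans Ei); rewrite En subnn.
  by rewrite permE /= subn1 /= /bump /= add1n En.
apply: one_line_bot_pos; apply: val_inj; apply: (etrans Ei); rewrite /= /bump /=.
by have := ltn_ord i; lia.
Qed.

(** From x one climbs by exchanging neighbouring entries in ascending order;
    lengths are bounded, so this stops, and a word with no such neighbours is
    decreasing. *)
Lemma bruhat_rev x : bruhat (simples_A n) x rev_A.
Proof.
move: (ltnSn (#|An n| - cox_length (simples_A n) x)); move: {2}_.+1 => k.
elim: k x => // k IHk x lt_k.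
have [[p q] /andP[/eqP/= pq lt_xpq]|no_asc] :=
  pickP (fun r : 'I_n.+1 * 'I_n.+1 => (r.2 == r.1.+1 :> nat) && (x r.1 < x r.2)).
  have xy : bruhat_step (simples_A n) x (transp_A p q * x).
    by apply/bruhat_step_A; exists p, q; rewrite pq.
  apply: connect_trans (connect1 xy) (IHk _ _).
  have lt_xy : cox_length (simples_A n) x < cox_length (simples_A n) (transp_A p q * x).
    by case/andP: xy.
  have : cox_length (simples_A n) (transp_A p q * x) <= #|An n|.
    by rewrite /cox_length -[X in _ <= X](size_iota 0); apply: find_size.
  lia.
suff -> : x = rev_A by apply: connect0.
apply/permP => p; rewrite permE -[LHS]rev_ordK; congr rev_ord.
apply: (increasing_fixed (rk := @nat_of_ord n.+1) (f := fun p => rev_ord (x p))).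
- exact: val_inj.
- exact: (@rk_pred _ _ (model_A n)).
- exact: inj_comp (@rev_ord_inj _) (@perm_inj _ x).
move=> r s rs; have := no_asc (r, s); rewrite /= rs eqxx /=.
have: x r != x s by apply/eqP => /perm_inj e; rewrite e in rs; lia.
rewrite -(inj_eq val_inj) /=.
by have := ltn_ord (x r); have := ltn_ord (x s); lia.
Qed.

End Bot.

Theorem theorem1p2 (n : nat) (hn : 1 <= n) :
  [/\ forall x y : An n,
        bruhat (simples_A n) x y <-> bruhat (simples_B n) (bot x) (bot y),
      [set bot x | x : An n] = lower_interval (simples_B n) (b0 n)
    & lower_interval (simples_B n) (b0 n) = [set w : Bn n | num_neg w <= 1]].
Proof.
have image : [set bot x | x : An n] = lower_interval (simples_B n) (b0 n).
  apply/setP=> w; rewrite inE -bot_rev; apply/imsetP/idP => [[x _ ->]|].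
    exact/bot_bruhat/bruhat_rev.
  by case/bot_bruhat_inv=> x ->; exists x.
split=> //; first exact: bot_bruhat.
rewrite -image; apply/setP=> w; rewrite inE; apply/imsetP/idP => [[x _ ->]|].
  exact: num_neg_bot.
by case/bot_onto=> x ->; exists x.
Qed.
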